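(* Let $T$ be a tree with nullity $1$ that has no eigenvalue in $(0,1)\cup(1,2)$. Then either $T$ is the one-vertex tree or $T=S(p)$ for some integer $p\geqslant 1$.
   Context: Eigenvalues are adjacency eigenvalues; the nullity of a graph is the multiplicity of $0$ as an eigenvalue. For a nonnegative integer $p$, $S(p)$ denotes the tree obtained from the path $v_1v_2v_3$ by attaching $p$ new leaves to $v_2$ and then attaching one new pendant vertex to each vertex of degree $1$ of the resulting tree; equivalently, $S(p)$ is the tree consisting of a center vertex $v_2$ together with $p+2$ pendant paths of length $2$ attached at $v_2$. *)

(* Defs.v *)
From HB Require Import structures.
From mathcomp Require Import all_boot all_order all_algebra.
From mathcomp Require Import reals.

Set Implicit Arguments.
Unset Strict Implicit.
Unset Printing Implicit Defensive.

Import Order.TTheory GRing.Theory Num.Theory.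
Local Open Scope ring_scope.

(* A graph is given by its adjacency relation on a finite vertex type. *)
Definition simple_graph (V : finType) (e : rel V) : Prop :=
  symmetric e /\ irreflexive e.

Definition connected_graph (V : finType) (e : rel V) : Prop :=
  (0 < #|V|)%N /\ forall x y : V, connect e x y.

(* The bound on the length excludes the empty sequence and the closed walks
   x, y, x along a single edge, both of which satisfy [ucycle]. *)
Definition acyclic_graph (V : finType) (e : rel V) : Prop :=
  forall c : seq V, (2 < size c)%N -> ~ ucycle e c.

Definition is_tree (V : finType) (e : rel V) : Prop :=
  [/\ simple_graph e, connected_graph e & acyclic_graph e].

Definition graph_iso (V W : finType) (e : rel V) (e' : rel W) : Prop :=
  exists2 f : V -> W, bijective f & forall x y : V, e' (f x) (f y) = e x y.

Definition adjacency (R : realType) (V : finType) (e : rel V) : 'M[R]_#|V| :=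
  \matrix_(i, j) (e (enum_val i) (enum_val j))%:R.

Definition nullity (R : realType) (V : finType) (e : rel V) : nat :=
  mup 0 (char_poly (adjacency R e)).

(* Vertices of S(p): [None] is the center v_2; for each of the p + 2 indices i,
   the pendant path of length 2 is None -- Some (i, false) -- Some (i, true). *)
Definition S_vertex (p : nat) : finType := option ('I_p.+2 * bool)%type.

Definition S_edge (p : nat) : rel (S_vertex p) := fun x y =>
  match x, y with
  | None, Some (_, b) | Some (_, b), None => ~~ b
  | Some (i, b), Some (j, c) => (i == j) && (b != c)
  | None, None => false
  end.
Arguments S_edge : clear implicits.

(* Main.v *)
Require Import Defs.
From HB Require Import structures.
From mathcomp Require Import all_boot all_order all_algebra.
From mathcomp Require Import reals.
From mathcomp Require Import complex spectral sesquilinear ring lra zify.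

(* A tree is bipartite, so with nullity 1 the kernel of the adjacency matrix is
   spanned by a vector supported on one colour class X; let Y be the other one
   and N the Y x X block.  Then N N^T has no eigenvalue in [0, 1), i.e.
   N N^T - 1 is positive semidefinite.  A leaf y in Y would give a zero diagonal
   entry of N N^T - 1, hence a zero row, which is impossible; so every vertex of
   Y has degree at least 2.  The rank is at most 2|Y|, so |V| <= 2|Y| + 1, and
   counting the |V| - 1 edges from Y shows that all these degrees are exactly 2:
   the tree is the subdivision of a tree on X.  Testing N N^T - 1 on (1, -1, 1)
   shows that having a common neighbour is transitive on Y, so by connectedness
   any two vertices of Y have a common neighbour, and by acyclicity all of them
   share the same one.  Hence the tree is a spider with |Y| legs of length 2.  It
   has the eigenvalue sqrt (|Y| + 1), which excludes |Y| = 1 and |Y| = 2. *)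

Set Implicit Arguments.
Unset Strict Implicit.
Unset Printing Implicit Defensive.

Import Order.TTheory GRing.Theory Num.Theory.
Local Open Scope ring_scope.

(** * Corank and the multiplicity of the root 0 *)

(** Let [L] invert the column factor of [A]. The rows of [L *m A] from the rank on vanish, so those
    rows of [L (X - A)] are [X] times constant rows; the determinant then yields the factor
    ['X^(n - r)]. *)
Lemma corank_le_mup (F : fieldType) (n : nat) (A : 'M[F]_n) :
  (n - \rank A <= mup 0 (char_poly A))%N.
Proof.
set r := \rank A.
pose L := invmx (col_ebase A).
pose D : 'rV[{poly F}]_n := \row_i (if (i < r)%N then 1 else 'X).
pose W : 'M[{poly F}]_n := \matrix_(i, j)
  if (i < r)%N then (map_mx polyC L *m char_poly_mx A) i j else (L i j)%:P.
have unitL : L \in unitmx by rewrite unitmx_inv col_ebase_unit.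
have LA : L *m A = pid_mx r *m row_ebase A.
  by rewrite -{1}[A]mulmx_ebase !mulmxA mulVmx ?col_ebase_unit ?mul1mx.
have eqW : map_mx polyC L *m char_poly_mx A = diag_mx D *m W.
  apply/matrixP => i j; rewrite mul_diag_mx [RHS]mxE [D 0 i]mxE [W i j]mxE.
  case: ifP => [_|ri]; first by rewrite mul1r.
  rewrite /char_poly_mx mulmxBr mul_mx_scalar -map_mxM LA !mxE big1 ?subr0 //.
  by move=> k _; rewrite mxE ri andbF mul0r.
have /(congr1 determinant) := eqW.
rewrite !det_mulmx det_diag det_map_mx => detE.
rewrite mup_geq ?monic_neq0 ?char_poly_monic // subr0.
have -> : ('X^(n - r) %| char_poly A) = ('X^(n - r) %| (\det L)%:P * char_poly A).
  by rewrite mul_polyC dvdpZr // -unitfE.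
rewrite detE dvdp_mulr //.
have -> : \prod_i D 0 i = 'X^(n - r) :> {poly F}; last exact: dvdpp.
under eq_bigr do rewrite mxE.
elim: (n) => [|m IHm]; first by rewrite big_ord0.
rewrite big_ord_recr /= IHm; case: ltnP => mr; last by rewrite subSn // exprSr.
(* Here [m < r], so both truncated exponents are 0. *)
by move: (mr) (ltnW mr); rewrite -!subn_eq0 mulr1 => /eqP -> /eqP ->.
Qed.

(** * Lower bounds for real symmetric forms *)

Section SymmetricForms.
Local Open Scope complex_scope.
Local Open Scope sesquilinear_scope.

(** Over [R[i]] the matrix is hermitian, hence unitarily diagonalisable with real diagonal [D]. In
    the coordinates [y] the forms become sums of [|y_i|^2] and of [D_i |y_i|^2], which compare term
    by term. *)
Lemma symmetric_form_ge (R : rcfType) (n : nat) (S : 'M[R]_n) (c : R) :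
    S^T = S -> (forall a, eigenvalue S a -> c <= a) ->
  forall x : 'rV_n, c * (x *m x^T) 0 0 <= (x *m S *m x^T) 0 0.
Proof.
move=> symS eigS x.
pose f : {rmorphism R -> R[i]} := real_complex R.
pose SC := map_mx f S; pose P := spectralmx SC; pose D := spectral_diag SC.
have hS : SC \is hermsymmx.
  apply: realsym_hermsym.
    by apply/is_hermitianmxP; rewrite expr0 scale1r map_mx_id // /SC map_trmx symS.
  by apply/mxOverP => i j; rewrite mxE complex_real.
have SCE : SC = invmx P *m diag_mx D *m P.
  exact/orthomx_spectralP/hermitian_normalmx.
have PV : invmx P = P ^t* by rewrite invmx_unitary // spectral_unitarymx.
have uP : P \in unitmx by exact: spectral_unit.
have DE i : D 0 i = f (complex.Re (D 0 i)).
  have /mxOverP/(_ 0 i) := hermitian_spectral_diag_real hS.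
  by rewrite -/D => /RRe_real.
have eigD i : c <= complex.Re (D 0 i).
  apply: eigS; rewrite eigenvalue_root_char -(fmorph_root f) map_char_poly -/SC.
  rewrite -DE -eigenvalue_root_char; apply/eigenvalueP; exists (row i P).
    by rewrite -row_mul SCE -mulmxA mulKVmx // row_mul row_diag_mx -scalemxAl -rowE.
  apply/eqP => r0; have /rowP/(_ i)/eqP : row i (P *m invmx P) = 0.
    by rewrite row_mul r0 mul0mx.
  by rewrite mulmxV // !mxE eqxx oner_eq0.
pose y := map_mx f x *m P ^t*.
have xt : (map_mx f x) ^t* = map_mx f x^T.
  by apply/matrixP => i j; rewrite !mxE; apply/CrealP; rewrite complex_real.
have yt : y ^t* = P *m map_mx f x^T.
  by rewrite /y trmx_mul map_mxM xt trmxCK.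
have sqy : f ((x *m x^T) 0 0) = \sum_i `|y 0 i| ^+ 2.
  transitivity ((y *m y ^t*) 0 0).
    by rewrite yt /y -PV mulmxA mulmxKV // -map_mxM [RHS]mxE.
  by rewrite mxE; apply: eq_bigr => i _; rewrite !mxE normCK.
have Sy : f ((x *m S *m x^T) 0 0) = \sum_i D 0 i * `|y 0 i| ^+ 2.
  transitivity ((y *m diag_mx D *m y ^t*) 0 0).
    by rewrite yt /y -PV !mulmxA -2!(mulmxA (map_mx f x)) -SCE -!map_mxM [RHS]mxE.
  rewrite mxE; apply: eq_bigr => i _.
  rewrite mul_mx_diag normCK mulrA [D 0 i * _]mulrC; congr (_ * _).
    by rewrite mxE.
  by rewrite !mxE.
rewrite -lecR -/f; change (f (c * (x *m x^T) 0 0) <= f ((x *m S *m x^T) 0 0)).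
rewrite rmorphM sqy Sy mulr_sumr; apply: ler_sum => i _.
by rewrite ler_wpM2r ?exprn_ge0 // DE lecR.
Qed.

End SymmetricForms.

(** * The adjacency operator on functions of the vertices *)

Lemma sum_enum_val (M : nmodType) (V : finType) (F : V -> M) :
  \sum_(i < #|V|) F (enum_val i) = \sum_v F v.
Proof. by rewrite (reindex (@enum_val V V)) //; apply/onW_bij/enum_val_bij. Qed.

Section NeighbourSums.
Variables (R : realType) (V : finType) (e : rel V).
Implicit Types (f g w : V -> R) (u v : V).

(** The action of the adjacency matrix on a function, free of the enumeration of [V]. *)
Definition nbr_sum f v : R := \sum_u f u * (e u v)%:R.

Definition fun_row f : 'rV[R]_#|V| := \row_i f (enum_val i).

Lemma fun_row_mul f (S : V -> V -> R) :
  fun_row f *m \matrix_(i, j) S (enum_val i) (enum_val j) =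
  fun_row (fun v => \sum_u f u * S u v).
Proof.
apply/rowP => j; rewrite !mxE -[RHS]sum_enum_val.
by apply: eq_bigr => i _; rewrite !mxE.
Qed.

Lemma fun_row_adjacency f : fun_row f *m adjacency R e = fun_row (nbr_sum f).
Proof. exact: fun_row_mul. Qed.

Lemma fun_rowP (x : 'rV[R]_#|V|) : exists f, x = fun_row f.
Proof.
by exists (fun v => x 0 (enum_rank v)); apply/rowP => i; rewrite !mxE enum_valK.
Qed.

Lemma exists_fun_neq0 f : fun_row f != 0 -> exists v, f v != 0.
Proof.
move=> f0; apply/existsP; apply: contraNT f0 => /existsPn f0.
apply/eqP/rowP => i; rewrite !mxE; apply/eqP.
by have := f0 (enum_val i); rewrite negbK.
Qed.

Lemma fun_row_neq0 f v : f v != 0 -> fun_row f != 0.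
Proof.
apply: contraNneq => /rowP/(_ (enum_rank v)).
by rewrite !mxE enum_rankK => ->.
Qed.

Lemma eigenvalue_adjacency f v a :
  f v != 0 -> (forall u, nbr_sum f u = a * f u) -> eigenvalue (adjacency R e) a.
Proof.
move=> fv fP; apply/eigenvalueP; exists (fun_row f); last exact: fun_row_neq0 fv.
by rewrite fun_row_adjacency; apply/rowP => i; rewrite !mxE fP.
Qed.

Lemma fun_form_ge (S : V -> V -> R) (c : R) :
    (forall u v, S u v = S v u) ->
    (forall f v a, f v != 0 -> (forall u, \sum_t f t * S t u = a * f u) ->
       c <= a) ->
  forall f, c * (\sum_v f v ^+ 2) <= \sum_v (\sum_u f u * S u v) * f v.
Proof.
move=> symS eigS f.
pose M : 'M[R]_#|V| := \matrix_(i, j) S (enum_val i) (enum_val j).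
have symM : M^T = M by apply/matrixP => i j; rewrite !mxE symS.
have dotE g h : (fun_row g *m (fun_row h)^T) 0 0 = \sum_v g v * h v.
  by rewrite mxE -[RHS]sum_enum_val; apply: eq_bigr => i _; rewrite !mxE.
have eigM a : eigenvalue M a -> c <= a.
  move=> /eigenvalueP[x]; have [g ->] := fun_rowP x.
  rewrite fun_row_mul => /rowP gE /exists_fun_neq0[v gv].
  apply: (eigS g v a gv) => u.
  by have := gE (enum_rank u); rewrite !mxE enum_rankK.
have := symmetric_form_ge symM eigM (fun_row f).
by rewrite fun_row_mul !dotE.
Qed.

Lemma nullity1_kernel : nullity R e = 1%N ->
  exists f, (exists v, f v != 0) /\ forall v, nbr_sum f v = 0.
Proof.
move=> null1.
have : eigenvalue (adjacency R e) 0.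
  rewrite eigenvalue_root_char; apply: contraPT null1 => /mupNroot.
  by rewrite /nullity => ->.
move=> /eigenvalueP[x]; have [g ->] := fun_rowP x.
rewrite fun_row_adjacency scale0r => /rowP gE g0; exists g; split.
  exact: exists_fun_neq0.
by move=> v; have := gE (enum_rank v); rewrite !mxE enum_rankK.
Qed.

Lemma nullity1_rank : nullity R e = 1%N -> (#|V| <= (\rank (adjacency R e)).+1)%N.
Proof.
move=> null1; have := corank_le_mup (adjacency R e).
by rewrite -/(nullity R e) null1 leq_subLR addn1.
Qed.

Lemma nullity1_proportional f g : nullity R e = 1%N ->
    (forall v, nbr_sum f v = 0) -> (forall v, nbr_sum g v = 0) ->
  forall u v, f u * g v = f v * g u.
Proof.
move=> null1 kerf kerg u v.
have subK h : (forall v, nbr_sum h v = 0) -> (fun_row h <= kermx (adjacency R e))%MS.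
  move=> kerh; apply/sub_kermxP; rewrite fun_row_adjacency.
  by apply/rowP => i; rewrite !mxE kerh.
have rkK : (\rank (kermx (adjacency R e)) <= 1)%N.
  by rewrite mxrank_ker leq_subLR addn1 nullity1_rank.
have [fu|fu] := eqVneq (fun_row f) 0.
  have f0 x : f x = 0 by have /rowP/(_ (enum_rank x)) := fu; rewrite !mxE enum_rankK.
  by rewrite !f0 !mul0r.
have : (fun_row g <= fun_row f)%MS.
  apply: submx_trans (subK _ kerg) _.
  rewrite -(mxrank_leqif_sup (subK _ kerf)) rank_rV fu.
  by have := mxrankS (subK _ kerf); rewrite rank_rV fu eqn_leq rkK andbT.
case/sub_rVP => a /rowP gE.
have ga x : g x = a * f x by have := gE (enum_rank x); rewrite !mxE enum_rankK.
by rewrite !ga; ring.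
Qed.

Variable P : pred V.
Hypothesis e_sym : symmetric e.
Hypothesis bipP : forall u v, e u v -> P u != P v.

(** [L] selects the coordinates in [P], and [L^T *m L] projects onto them. Each edge has exactly one
    end in [P], so [A] is the sum of its rows in [P] and its columns in [P]; each summand factors
    through dimension [#|P|]. *)
Lemma rank_adjacency_bipartite : (\rank (adjacency R e) <= 2 * #|P|)%N.
Proof.
pose L : 'M[R]_(#|P|, #|V|) := \matrix_(i, j) (enum_val i == enum_val j)%:R.
have rkL : (\rank L <= #|P|)%N by exact: rank_leq_row.
have rkLT : (\rank L^T <= #|P|)%N by exact: rank_leq_col.
pose A := adjacency R e.
have LL i j : (L^T *m L) i j = ((i == j) && P (enum_val i))%:R.
  rewrite mxE.
  under eq_bigr do rewrite !mxE.
  rewrite -(big_enum_val (fun x => (x == enum_val i)%:R * (x == enum_val j)%:R)) /=.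
  case: (boolP (P (enum_val i))) => Pi; last first.
    rewrite andbF big1 // => x Px; case: eqP => [xi|]; last by rewrite mul0r.
    by rewrite xi in Px; rewrite -topredE /= (negPf Pi) in Px.
  rewrite (bigD1 (enum_val i)) //= eqxx mul1r big1 ?addr0 => [|x].
    by rewrite andbT (inj_eq enum_val_inj).
  by case/andP=> _ /negPf->; rewrite mul0r.
have LLA i j : (L^T *m L *m A) i j = (P (enum_val i))%:R * A i j.
  rewrite mxE (bigD1 i) //= big1 => [|k ki]; last first.
    by rewrite LL eq_sym (negPf ki) mul0r.
  by rewrite LL eqxx addr0.
have ALL i j : (A *m (L^T *m L)) i j = A i j * (P (enum_val j))%:R.
  rewrite mxE (bigD1 j) //= big1 => [|k kj]; last first.
    by rewrite LL (negPf kj) mulr0.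
  by rewrite LL eqxx addr0.
have AE : A = L^T *m (L *m A) + (A *m L^T) *m L.
  apply/matrixP => i j; rewrite mulmxA -[A *m _ *m _]mulmxA [RHS]mxE LLA ALL mxE.
  have := @bipP (enum_val i) (enum_val j).
  case: (e _ _) => [/(_ isT)|_]; last by rewrite mulr0 mul0r addr0.
  by case: (P _); case: (P _) => // _; rewrite mulr1 mul1r ?addr0 ?add0r.
rewrite -/A AE.
rewrite (leq_trans (mxrank_add _ _)) // mul2n -addnn leq_add //.
  by rewrite (leq_trans (mxrankM_maxl _ _)).
by rewrite (leq_trans (mxrankM_maxr _ _)).
Qed.

Lemma nbr_sum_off w u :
  (forall v, ~~ P v -> w v = 0) -> P u -> nbr_sum w u = 0.
Proof.
move=> wP Pu; apply: big1 => v _; case: (boolP (e v u)) => [/bipP|]; last by rewrite mulr0.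
by rewrite Pu; case: (boolP (P v)) => // Pv _; rewrite wP ?mul0r.
Qed.

Hypothesis no01 : forall a : R, eigenvalue (adjacency R e) a -> ~ (0 < a < 1).
Hypothesis kerP : forall w, (forall v, ~~ P v -> w v = 0) ->
  (forall v, nbr_sum w v = 0) -> forall v, w v = 0.

(* [N N^T >= 1], where [N] is the [P x ~P] block of the adjacency matrix. *)
Lemma nbr_sum_expands w : (forall v, ~~ P v -> w v = 0) ->
  \sum_v w v ^+ 2 <= \sum_v nbr_sum w v ^+ 2.
Proof.
pose A2 u v : R := \sum_k (e u k)%:R * (e k v)%:R.
have A2E f v : \sum_u f u * A2 u v = nbr_sum (nbr_sum f) v.
  rewrite /nbr_sum; under eq_bigr do rewrite /A2 mulr_sumr.
  rewrite exchange_big /=; apply: eq_bigr => k _; rewrite mulr_suml.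
  by apply: eq_bigr => u _; rewrite mulrA.
have A2sym u v : A2 u v = A2 v u.
  by apply: eq_bigr => k _; rewrite mulrC (e_sym k v) (e_sym u k).
have A2form f : \sum_v nbr_sum (nbr_sum f) v * f v = \sum_v nbr_sum f v ^+ 2.
  rewrite /nbr_sum; under eq_bigr do rewrite mulr_suml.
  rewrite exchange_big /=; apply: eq_bigr => u _.
  rewrite expr2 mulr_sumr; apply: eq_bigr => v _.
  by rewrite (e_sym u v) -mulrA; congr (_ * _); rewrite mulrC.
(* [S] is [N N^T] on [P], padded by the identity elsewhere; the padding adds only the eigenvalue 1,
   which respects the bound. *)
pose S u v : R := if P u && P v then A2 u v else (u == v)%:R.
have SE f v : (forall v, ~~ P v -> f v = 0) -> \sum_u f u * S u v = nbr_sum (nbr_sum f) v.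
  move=> fP; case: (boolP (P v)) => Pv.
    rewrite -A2E; apply: eq_bigr => u _; rewrite /S Pv andbT.
    by case: ifPn => // /fP ->; rewrite !mul0r.
  rewrite [RHS]big1 => [|u _].
    apply: big1 => u _; case: (boolP (P u)) => [Pu|/fP ->]; last by rewrite mul0r.
    rewrite /S (negPf Pv) andbF; case: eqP => [uv|]; last by rewrite mulr0.
    by rewrite -uv Pu in Pv.
  case: (boolP (e u v)) => [/bipP|]; last by rewrite mulr0.
  by rewrite (negPf Pv); case: (boolP (P u)) => // Pu _; rewrite nbr_sum_off ?mul0r.
move=> wP; suff : 1 * (\sum_v w v ^+ 2) <= \sum_v (\sum_u w u * S u v) * w v.
  by rewrite mul1r -A2form; under [X in _ <= X]eq_bigr do rewrite SE //.
apply: fun_form_ge => [u v|f v a fv fE].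
- by rewrite /S andbC eq_sym A2sym.
- case: (ltP a 1) => // a1; exfalso.
  (* On the padding [f u = a * f u], and [a < 1] forces [f u = 0]. *)
  have fP u : ~~ P u -> f u = 0.
    move=> Pu; have := fE u; rewrite (bigD1 u) //= /S (negPf Pu) andbF eqxx.
    rewrite big1 => [|t /negPf ->]; last by rewrite andbF mulr0.
    rewrite addr0 mulr1 => /eqP; rewrite -subr_eq0 -{1}[f u]mul1r -mulrBl mulf_eq0.
    by case/orP => /eqP // a0; lra.
  have fA u : nbr_sum (nbr_sum f) u = a * f u by rewrite -fE SE.
  have sqE : a * \sum_u f u ^+ 2 = \sum_u nbr_sum f u ^+ 2.
    by rewrite -A2form mulr_sumr; apply: eq_bigr => u _; rewrite fA -mulrA.
  have sq0 : 0 < \sum_u f u ^+ 2.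
    rewrite (bigD1 v) //= ltr_pwDl ?sumr_ge0 // => [|u _]; last exact: sqr_ge0.
    by rewrite lt_def sqrf_eq0 fv sqr_ge0.
  have a0 : 0 <= a.
    rewrite -(pmulr_lge0 _ sq0) sqE; apply: sumr_ge0 => u _; exact: sqr_ge0.
  (* If [a = 0], then [f] is a kernel vector supported on [P], against [kerP]. *)
  have an0 : a != 0.
    apply: contraNneq fv => aE; rewrite kerP // => u.
    move/eqP: sqE; rewrite aE mul0r eq_sym psumr_eq0 => [|t _]; last exact: sqr_ge0.
    by move/allP/(_ u (mem_index_enum _)); rewrite sqrf_eq0 => /eqP.
  pose b : R := Num.sqrt a.
  have b2 : b ^+ 2 = a by rewrite sqr_sqrtr.
  have b0 : 0 < b by rewrite sqrtr_gt0 lt_def an0.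
  apply: (@no01 b); last by rewrite b0 /= -sqrtr1 ltr_sqrt.
  (* As [b ^+ 2 = a], the adjacency operator [A] sends [b f + A f] to [b A f + b^2 f], which is [b]
     times it; so [b] is an eigenvalue strictly between 0 and 1. *)
  pose g u : R := b * f u + nbr_sum f u.
  apply: (@eigenvalue_adjacency g v b).
    rewrite /g [nbr_sum f v]nbr_sum_off ?addr0 //.
      by rewrite mulf_neq0 // gt_eqF.
    by apply: contraNT fv => Pv; rewrite fP.
  move=> u; have -> : nbr_sum g u = b * nbr_sum f u + nbr_sum (nbr_sum f) u.
    rewrite /nbr_sum mulr_sumr -big_split /=; apply: eq_bigr => t _.
    by rewrite /g mulrDl mulrA.
  by rewrite fA -b2 /g; ring.
Qed.

End NeighbourSums.

(** * Trees: distances from a root and edge counting *)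

Section Trees.
Local Open Scope nat_scope.
Variables (V : finType) (e : rel V).
Hypothesis e_sym : symmetric e.
Hypothesis e_irr : irreflexive e.
Hypothesis e_acyclic : acyclic_graph e.
Hypothesis e_conn : forall x y, connect e x y.

Lemma connect_invariant (C : pred V) x y :
  (forall u v, C u -> e u v -> C v) -> C x -> C y.
Proof.
move=> step Cx; have /connectP[p] := e_conn x y.
elim: p x Cx => [|z p IHp] x Cx /=; first by move=> _ ->.
by case/andP=> /(step _ _ Cx) Cz; apply: IHp.
Qed.

Lemma edge_neq u v : e u v -> u != v.
Proof. by apply: contraTneq => ->; rewrite e_irr. Qed.

Definition avoid v : rel V := [rel x y | [&& e x y, x != v & y != v]].

Lemma avoid_sym v : connect_sym (avoid v).
Proof.
by apply: sym_connect_sym => x y; rewrite /avoid /= e_sym [(x != v) && _]andbC.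
Qed.

(** A duplicate-free path from [u] to [w] avoiding [v], closed up through [v], is a cycle of length
    at least 3 once [u] and [w] differ. *)
Lemma acyclic_no_bypass u v w :
  e v u -> e v w -> connect (avoid v) u w -> u = w.
Proof.
move=> vu vw /connectP[p0 /shortenP[p pp up _] wE].
apply/eqP; apply: contraT => uw; exfalso.
have pv : all (predC1 v) p.
  elim: (p) (u) pp => //= x q IHq y /andP[/and3P[_ _ ->]] /IHq //.
have pe : path e u p by apply: sub_path pp => x y /and3P[].
apply: (e_acyclic (c := v :: u :: p)).
  by case: (p) wE uw => //= wE; rewrite wE eqxx.
rewrite /ucycle /= rcons_path -wE vu pe e_sym vw /=.
move: up; rewrite inE negb_or (edge_neq vu) /= => -> ; rewrite andbT.
by apply/negP => /(allP pv); rewrite /= eqxx.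
Qed.

Lemma acyclic_no_4cycle a b c d :
  e a b -> e b c -> e c d -> e d a -> a != c -> b = d.
Proof.
move=> ab bc cd da ac; apply: (@acyclic_no_bypass b a d) => //; first by rewrite e_sym.
apply: (@connect_trans _ _ c); apply: connect1; rewrite /avoid /=.
  by rewrite bc ![_ == a]eq_sym (edge_neq ab).
by rewrite cd (edge_neq da) eq_sym ac.
Qed.

Lemma acyclic_no_6cycle a b c d x y :
  e a b -> e b c -> e c d -> e d x -> e x y -> e y a ->
  uniq [:: a; b; c; d; x; y] -> False.
Proof.
move=> ab bc cd dx xy ya un; apply: (e_acyclic (c := [:: a; b; c; d; x; y])) => //.
by rewrite /ucycle un /= ab bc cd dx xy ya.
Qed.

Variable r : V.

(** Quantifying over tuples of a fixed length keeps the predicate boolean, as [ex_minn] requires. *)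
Lemma exists_dist v : exists n, [exists p : n.-tuple V, path e r p && (last r p == v)].
Proof.
have /connectP[p pp vE] := e_conn r v.
by exists (size p); apply/existsP; exists (in_tuple p); rewrite pp vE eqxx.
Qed.

Definition dist v := ex_minn (exists_dist v).

Lemma dist_le p v : path e r p -> last r p = v -> dist v <= size p.
Proof.
move=> pp pv; rewrite /dist; case: ex_minnP => n _; apply.
by apply/existsP; exists (in_tuple p); rewrite pp pv eqxx.
Qed.

Lemma dist_path v : exists p, [/\ path e r p, last r p = v & size p = dist v].
Proof.
rewrite /dist; case: ex_minnP => n /existsP[p /andP[pp /eqP pv]] _.
by exists p; rewrite size_tuple.
Qed.

Lemma dist_eq0 v : dist v = 0 -> v = r.
Proof. by have [[|x p] [_ <- <-]] := dist_path v. Qed.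

Lemma dist_root : dist r = 0.
Proof. by apply/eqP; rewrite -leqn0; apply: (@dist_le [::]). Qed.

Lemma dist_edge u v : e u v -> dist v <= (dist u).+1.
Proof.
move=> uv; have [p [pp pu <-]] := dist_path u.
by rewrite -(size_rcons p v) dist_le ?last_rcons // rcons_path pp pu.
Qed.

Lemma dist_parent v n : dist v = n.+1 -> exists2 u, e u v & dist u = n.
Proof.
move=> vn; have [p [+ + +]] := dist_path v; rewrite vn.
case/lastP: p => [|p x] //; rewrite rcons_path last_rcons size_rcons.
move=> /andP[pp pe] xv [pn]; rewrite xv in pe; exists (last r p) => //.
by have := dist_le pp erefl; have := dist_edge pe; lia.
Qed.

(** Walking from [u] to the root along parents lowers the distance, so every vertex after [u] is
    strictly closer to [r] than [v]. *)
Lemma connect_root_avoid u v :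
  u != v -> dist u <= dist v -> connect (avoid v) u r.
Proof.
elim: {u}_.+1 {-2}u (ltnSn (dist u)) => // n IHn u un uv duv.
case du: (dist u) => [|m]; first by rewrite (dist_eq0 du) connect0.
have [w wu wm] := dist_parent du.
have wv : w != v by apply: contraTneq duv => <-; lia.
apply: (@connect_trans _ _ w); last by apply: IHn; lia.
by apply: connect1; rewrite /avoid /= e_sym wu uv.
Qed.

Lemma parent_unique u v w :
  e u v -> e w v -> dist u < dist v -> dist w < dist v -> u = w.
Proof.
move=> uv wv du dw; apply: (@acyclic_no_bypass u v w); rewrite 1?e_sym //.
apply: (@connect_trans _ _ r).
  by apply: connect_root_avoid; [exact: edge_neq | exact: ltnW].
by rewrite avoid_sym; apply: connect_root_avoid; [exact: edge_neq | exact: ltnW].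
Qed.

(** Otherwise [u] and the parent [w] of [v] would be distinct neighbours of [v], joined through the
    root by a walk avoiding [v]. *)
Lemma dist_edge_neq u v : e u v -> dist u != dist v.
Proof.
move=> uv; apply/eqP => duv; case dv: (dist v) => [|m].
  by move: (edge_neq uv); rewrite (dist_eq0 dv) (dist_eq0 (etrans duv dv)) eqxx.
have [w wv wm] := dist_parent dv.
suff uw : u = w by rewrite uw in duv; lia.
apply: (@acyclic_no_bypass u v w); rewrite 1?e_sym //.
apply: (@connect_trans _ _ r).
  by apply: connect_root_avoid; [exact: edge_neq | rewrite duv].
rewrite avoid_sym; apply: connect_root_avoid; [exact: edge_neq | lia].
Qed.

Lemma odd_dist_edge u v : e u v -> odd (dist u) != odd (dist v).
Proof.
move=> uv; have := dist_edge_neq uv; have := dist_edge uv.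
by move: uv; rewrite e_sym => /dist_edge; lia.
Qed.

(** Every edge has one end in [P] and one end farther from [r], so it may be counted at either. Each
    vertex has at most one parent and [r] has none, so there are fewer than [#|V|] edges. *)
Lemma sum_degrees_lt (P : pred V) : (forall u v, e u v -> P u != P v) ->
  \sum_(y | P y) #|[set x | e y x]| < #|V|.
Proof.
move=> bipP.
pose up v := \sum_u (e u v && (dist u < dist v) : nat).
have up_le v : up v <= (v != r).
  have [->|vr] := eqVneq v r.
    by rewrite /up big1 // => u _; rewrite dist_root ltn0 andbF.
  case: (pickP [pred u | e u v && (dist u < dist v)]) => [u /= /andP[uv du]|no].
    rewrite /up (bigD1 u) //= uv du big1 // => w wu.
    apply/eqP; rewrite eqb0; apply: contraNN wu => /andP[wv dw].
    by rewrite (parent_unique wv uv).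
  by rewrite /up big1 // => u _; have /= -> := no u.
have upV : \sum_v up v < #|V|.
  apply: (@leq_ltn_trans (\sum_v (v != r : nat))); first exact: leq_sum.
  have -> : \sum_v (v != r : nat) = #|predC1 r|.
    rewrite -sum1_card [RHS]big_mkcond /=; apply: eq_bigr => v _.
    by rewrite !inE; case: (v == r).
  by rewrite cardC1; have : 0 < #|V| by [apply/card_gt0P; exists r]; lia.
apply: leq_ltn_trans upV.
have degE y : P y -> #|[set x | e y x]| =
    up y + \sum_(x | ~~ P x) (e y x && (dist y < dist x)).
  move=> Py; rewrite cardsE -sum1_card big_mkcond /=.
  rewrite [X in _ + X]big_mkcond /= -big_split /=; apply: eq_bigr => x _.
  rewrite -topredE /= (e_sym x); case: (boolP (e y x)) => [yx|] /=; last by case: ifP.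
  have -> : ~~ P x by have := bipP _ _ yx; rewrite Py; case: (P x).
  by have := dist_edge_neq yx; lia.
rewrite (eq_bigr _ degE) big_split /= (bigID P xpredT) /=.
rewrite leq_add2l exchange_big /=; apply: leq_sum => x Px.
rewrite /up [X in _ <= X](bigID P) /=; exact: leq_addr.
Qed.

End Trees.

(** * Consequences of the expansion inequality for degrees and common neighbours *)

Section CommonNeighbours.
Variables (R : realType) (V : finType) (e : rel V) (P : pred V).
Hypothesis expands : forall w : V -> R, (forall v, ~~ P v -> w v = 0) ->
  \sum_v w v ^+ 2 <= \sum_v nbr_sum e w v ^+ 2.

(** Entries of [A A^T] for the adjacency matrix [A]; on [P], those of [N N^T]. *)
Definition common y z : R := \sum_v (e y v)%:R * (e z v)%:R.

Lemma common_degree y : common y y = #|[set x | e y x]|%:R.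
Proof.
rewrite /common cardsE -sum1_card natr_sum [RHS]big_mkcond /=.
by apply: eq_bigr => x _; rewrite -topredE /=; case: (e y x); rewrite ?mulr1 ?mulr0.
Qed.

Lemma common_ge1 y z x : e y x -> e z x -> 1 <= common y z.
Proof.
move=> yx zx; rewrite /common (bigD1 x) //= yx zx mulr1 lerDl.
by apply: sumr_ge0 => v _; rewrite mulr_ge0.
Qed.

Lemma common_eq0 y z : (forall x, e y x -> ~~ e z x) -> common y z = 0.
Proof.
move=> no; apply: big1 => x _; case: (boolP (e y x)) => [/no/negPf ->|].
  by rewrite mulr0.
by rewrite mul0r.
Qed.

Let delta (y v : V) : R := (y == v)%:R.

Lemma sum_delta y : \sum_v delta y v = 1.
Proof.
rewrite (bigD1 y) //= /delta eqxx big1 ?addr0 // => v /negPf.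
by rewrite eq_sym => ->.
Qed.

Lemma nbr_sum_delta3 a y b z c t v :
  nbr_sum e (fun u => a * delta y u + b * delta z u + c * delta t u) v =
  a * (e y v)%:R + b * (e z v)%:R + c * (e t v)%:R.
Proof.
have one x : \sum_u delta x u * (e u v)%:R = (e x v)%:R.
  rewrite (bigD1 x) //= /delta eqxx mul1r big1 ?addr0 // => u /negPf.
  by rewrite eq_sym => ->; rewrite mul0r.
rewrite -!one !mulr_sumr -!big_split /=; apply: eq_bigr => u _; ring.
Qed.

(** This is [expands] for a vector supported on at most three vertices. A zero weight lets a vertex
    repeat, so that one or two vertices can be tested as well. *)
Lemma delta3_form a y b z c t : P y -> P z -> P t ->
    b = 0 \/ y != z -> c = 0 \/ (t != y /\ t != z) ->
  a ^+ 2 + b ^+ 2 + c ^+ 2 <=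
  a ^+ 2 * common y y + b ^+ 2 * common z z + c ^+ 2 * common t t +
  2 * a * b * common y z + 2 * b * c * common z t + 2 * a * c * common y t.
Proof.
move=> Py Pz Pt bz ct.
pose w u := a * delta y u + b * delta z u + c * delta t u.
have wP v : ~~ P v -> w v = 0.
  have dP x : P x -> ~~ P v -> delta x v = 0.
    by move=> Px Pv; rewrite /delta; case: eqP => // xv; rewrite -xv Px in Pv.
  by move=> Pv; rewrite /w !dP // !mulr0 !addr0.
have := expands wP.
have -> : \sum_v w v ^+ 2 = a ^+ 2 + b ^+ 2 + c ^+ 2.
  rewrite -[a ^+ 2]mulr1 -[b ^+ 2]mulr1 -[c ^+ 2]mulr1.
  rewrite -{1}(sum_delta y) -{1}(sum_delta z) -(sum_delta t).
  rewrite !mulr_sumr -!big_split /=; apply: eq_bigr => v _; rewrite /w /delta.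
  have [<-|_] := eqVneq y v.
    rewrite [z == y]eq_sym; case: ct => [->|[/negPf -> _]];
    by case: bz => [->|/negPf ->]; rewrite /=; ring.
  have [<-|_] := eqVneq z v.
    case: ct => [->|[_ /negPf ->]]; rewrite /=; ring.
  by case: (t == v); rewrite /=; ring.
under [X in _ <= X]eq_bigr do rewrite nbr_sum_delta3.
congr (_ <= _); rewrite /common !mulr_sumr -!big_split /=.
by apply: eq_bigr => v _; ring.
Qed.

Lemma degree_gt0 y : P y -> (0 < #|[set x | e y x]|)%N.
Proof.
move=> Py; have := @delta3_form 1 y 0 y 0 y Py Py Py (or_introl erefl) (or_introl erefl).
rewrite common_degree => form; rewrite -(ltr_nat R); lra.
Qed.

Lemma degree_gt1 y z x : P y -> P z -> y != z -> e y x -> e z x ->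
  (1 < #|[set u | e y u]|)%N.
Proof.
move=> Py Pz yz yx zx; rewrite ltnNge; apply/negP => dy.
(* With [d = common z z] and [y] of degree at most 1, the weights [-d] at [y] and 1 at [z] give
   [d^2 + 1 <= d^2 + d - 2 d common y z], impossible since [d] and [common y z] are at least 1. *)
have := @delta3_form (- common z z) y 1 z 0 y Py Pz Py (or_intror yz) (or_introl erefl).
have : common y y <= 1 by rewrite common_degree (ler_nat R _ 1).
have := common_ge1 yx zx; have := common_ge1 zx zx; nra.
Qed.

(* Otherwise the vector with entries 1, -1, 1 at y, z, t violates [expands]. *)
Lemma share_trans y z t x x' : P y -> P z -> P t ->
  #|[set u | e y u]| = 2 -> #|[set u | e z u]| = 2 -> #|[set u | e t u]| = 2 ->
  e y x -> e z x -> e z x' -> e t x' -> exists2 u, e y u & e t u.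
Proof.
move=> Py Pz Pt dy dz dt yx zx zx' tx'.
have [yz|yz] := eqVneq y z; first by exists x'; rewrite ?yz.
have [tz|tz] := eqVneq t z; first by exists x; rewrite ?tz.
have [ty|ty] := eqVneq t y; first by exists x; rewrite ?ty.
case: (pickP [pred u | e y u && e t u]) => [u /= /andP[yu tu]|no]; first by exists u.
exfalso; have := @delta3_form 1 y (-1) z 1 t Py Pz Pt (or_intror yz) (or_intror (conj ty tz)).
rewrite !common_degree dy dz dt.
have -> : common y t = 0.
  by apply: common_eq0 => u yu; have /= := no u; rewrite yu => /negbT.
have := common_ge1 yx zx; have := common_ge1 zx' tx'; lra.
Qed.

End CommonNeighbours.

(** * Spiders: the centre, the legs and one eigenvalue *)

Section Spider.
Variables (V : finType) (e : rel V) (P : pred V).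
Hypothesis e_sym : symmetric e.
Hypothesis e_irr : irreflexive e.
Hypothesis e_acyclic : acyclic_graph e.
Hypothesis e_conn : forall x y, connect e x y.
Hypothesis bipP : forall u v, e u v -> P u != P v.
Hypothesis deg2 : forall y, P y -> #|[set x | e y x]| = 2%N.

(** Let [a] and [b] be the neighbours of [y0]. If [y1] misses [a] and [y2] misses [b], then [y1]
    meets [b], [y2] meets [a], and a common neighbour [c] of [y1] and [y2] closes the 6-cycle
    [a y2 c y1 b y0]. So [a] or [b] is a centre. *)
Lemma exists_center y0 :
    (forall y z, P y -> P z -> exists2 u, e y u & e z u) -> P y0 ->
  exists c, forall y, P y -> e y c.
Proof.
move=> share Py0; have /eqP/cards2P[a [b [ab /setP N0]]] := deg2 Py0.
have yN0 u : e y0 u = (u == a) || (u == b) by have := N0 u; rewrite !inE.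
have ya : e y0 a by rewrite yN0 eqxx.
have yb : e y0 b by rewrite yN0 eqxx orbT.
have sh y : P y -> e y a || e y b.
  move=> Py; have [u] := share y0 y Py0 Py.
  by rewrite yN0 => /orP[] /eqP -> ->; rewrite ?orbT.
case: (pickP [pred y | P y && ~~ e y a]) => [y1 /= /andP[Py1 y1a]|all_a]; last first.
  by exists a => y Py; have /= := all_a y; rewrite Py => /negbFE.
exists b => y2 Py2; apply: contraT => y2b; exfalso.
have y1b : e y1 b by have := sh _ Py1; rewrite (negPf y1a).
have y2a : e y2 a by have := sh _ Py2; rewrite (negPf y2b) orbF.
have [c y1c y2c] := share y1 y2 Py1 Py2.
have Pneq x y : e y x -> P y -> ~~ P x.
  by move=> /bipP + Py; rewrite Py; case: (P x).
have Pa := Pneq _ _ ya Py0; have Pb := Pneq _ _ yb Py0; have Pc := Pneq _ _ y1c Py1.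
apply: (@acyclic_no_6cycle _ e e_acyclic a y2 c y1 b y0) => //; rewrite 1?e_sym //.
have neq x y : P x -> ~~ P y -> (x != y) && (y != x).
  by move=> Px Py; rewrite [y == x]eq_sym andbb; apply: contraNneq Py => <-.
have neqe x y z : e x z -> ~~ e y z -> (x != y) && (y != x).
  by move=> xz yz; rewrite [y == x]eq_sym andbb; apply: contraNneq yz => <-.
have neqe' x y z : e z x -> ~~ e z y -> (x != y) && (y != x).
  by move=> xz yz; rewrite [y == x]eq_sym andbb; apply: contraNneq yz => <-.
have [_ ca] := andP (neqe' _ _ _ y1c y1a).
have [cb _] := andP (neqe' _ _ _ y2c y2b).
have [y21 _] := andP (neqe _ _ _ y2a y1a).
have [_ y20] := andP (neqe _ _ _ yb y2b).
have [_ y10] := andP (neqe _ _ _ ya y1a).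
have [_ a2] := andP (neq _ _ Py2 Pa); have [_ a1] := andP (neq _ _ Py1 Pa).
have [_ a0] := andP (neq _ _ Py0 Pa); have [y2c' _] := andP (neq _ _ Py2 Pc).
have [_ c1] := andP (neq _ _ Py1 Pc); have [_ c0] := andP (neq _ _ Py0 Pc).
have [y1b' _] := andP (neq _ _ Py1 Pb); have [y2b' _] := andP (neq _ _ Py2 Pb).
have [_ b0] := andP (neq _ _ Py0 Pb).
rewrite /= !inE !negb_or; do !(apply/andP; split) => //.
Qed.

Variable c : V.
Hypothesis center : forall y, P y -> e y c.
Hypothesis P_gt0 : (0 < #|P|)%N.

Lemma center_notin : ~~ P c.
Proof.
have /card_gt0P[y Py] := P_gt0; have := bipP (center Py).
by rewrite -topredE /= in Py; rewrite Py; case: (P c).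
Qed.

(** For [y] in [P], the degree 2 ensures that the default [c] is not taken. *)
Definition leg y := odflt c [pick x | e y x && (x != c)].

Lemma legP y : P y -> [/\ e y (leg y), leg y != c & ~~ P (leg y)].
Proof.
move=> Py; rewrite /leg; case: pickP => [x /andP[yx xc] /=|no].
  by split=> //; have := bipP yx; rewrite Py; case: (P x).
have := deg2 Py; rewrite (_ : [set x | e y x] = [set c]) ?cards1 //.
apply/setP => x; rewrite !inE; have := no x.
by case: (eqVneq x c) => [->|]; rewrite ?center ?andbT.
Qed.

Lemma nbr_leg y x : P y -> e y x = (x == c) || (x == leg y).
Proof.
move=> Py; have [ly lc _] := legP Py.
have /setP/(_ x) : [set c; leg y] = [set x | e y x].
  apply/eqP; rewrite eqEcard cards2 eq_sym lc deg2 // andbT.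
  by apply/subsetP => u; rewrite !inE => /orP[] /eqP -> //; apply: center.
by rewrite !inE.
Qed.

(** Otherwise [c], [y], [leg z], [z] would form a 4-cycle. *)
Lemma leg_inj_edge y z : P y -> P z -> e y (leg z) -> y = z.
Proof.
move=> Py Pz yz; have [lz lc _] := legP Pz.
apply: (@acyclic_no_4cycle _ e e_sym e_irr e_acyclic c y (leg z) z) => //.
- by rewrite e_sym center.
- by rewrite e_sym.
- exact: center.
- by rewrite eq_sym.
Qed.

(** The injection [h] of the spider into the tree preserves and reflects edges, and the bound on
    [#|V|] leaves no further vertices. *)
Lemma spider_iso p : #|P| = p.+2 -> (#|V| <= (2 * #|P|).+1)%N ->
  graph_iso e (S_edge p).
Proof.
move=> kE cardV.
pose en (i : 'I_p.+2) : V := enum_val (cast_ord (esym kE) i).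
have Pen i : P (en i) by have := enum_valP (cast_ord (esym kE) i).
have en_inj : injective en by move=> i j /enum_val_inj/cast_ord_inj.
pose h (x : S_vertex p) : V :=
  match x with
  | None => c
  | Some (i, b) => if b then leg (en i) else en i
  end.
have Pc := center_notin.
have Ph x : P (h x) = if x is Some (_, false) then true else false.
  case: x => [[i []]|] /=; last exact: negPf.
    by have [_ _ /negPf] := legP (Pen i).
  exact: Pen.
have h_edge x y : e (h x) (h y) = S_edge p x y.
  have eP u v : P u = P v -> e u v = false.
    by move=> uv; apply/negP => /bipP; rewrite uv eqxx.
  have el i j : e (en i) (leg (en j)) = (i == j).
    apply/idP/eqP => [|->]; last by have [] := legP (Pen j).
    by move/(leg_inj_edge (Pen i) (Pen j))/en_inj.
  case: x y => [[i []]|] [[j []]|] /=.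
  - by rewrite andbF eP // (Ph (Some (i, true))) (Ph (Some (j, true))).
  - by rewrite andbT e_sym el eq_sym.
  - by rewrite eP // (Ph (Some (i, true))) (Ph None).
  - by rewrite andbT el.
  - by rewrite andbF eP // !Pen.
  - by rewrite center.
  - by rewrite eP // (Ph (Some (j, true))) (Ph None).
  - by rewrite e_sym center.
  - exact: e_irr.
have h_inj : injective h.
  move=> x y hxy; have := Ph x; rewrite hxy Ph => {}.
  case: x y hxy => [[i []]|] [[j []]|] //= hxy _.
  - have [yl _ _] := legP (Pen i); rewrite hxy in yl.
    by rewrite (en_inj _ _ (leg_inj_edge (Pen i) (Pen j) yl)).
  - by have [_ + _] := legP (Pen i); rewrite hxy eqxx.
  - by rewrite (en_inj _ _ hxy).
  - by have [_ + _] := legP (Pen j); rewrite -hxy eqxx.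
have [|g hK gK] := inj_card_bij h_inj.
  by rewrite card_option card_prod card_ord card_bool; lia.
exists g; first by exists h.
by move=> x y; rewrite -h_edge !gK.
Qed.

(** With [k = #|P|] and [l ^+ 2 = k + 1], an eigenvector takes the value [k] at the centre, [l] on
    [P] and 1 at the ends of the legs: the equations are [k l = l k], [k + 1 = l l] and
    [l = l 1]. *)
Lemma spider_eigenvalue (R : realType) :
  eigenvalue (adjacency R e) (Num.sqrt (#|P|.+1%:R)).
Proof.
set k := #|P|; set l : R := Num.sqrt _.
have l2 : l * l = k.+1%:R by rewrite -expr2 sqr_sqrtr.
have Pc := center_notin.
pose f v : R := if v == c then k%:R else if P v then l else 1.
have fP y : P y -> f y = l.
  by move=> Py; rewrite /f Py; case: eqP => // yc; rewrite -yc Py in Pc.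
apply: (@eigenvalue_adjacency _ _ _ f c).
  by rewrite /f eqxx pnatr_eq0 -lt0n.
move=> v; rewrite /nbr_sum.
have [->|vc] := eqVneq v c.
  transitivity (\sum_(u | P u) l).
    rewrite [RHS]big_mkcond /=; apply: eq_bigr => u _; case: ifP => Pu.
      by rewrite center // fP // mulr1.
    case: (boolP (e u c)) => [/bipP|]; last by rewrite mulr0.
    by rewrite Pu (negPf Pc).
  by rewrite sumr_const /f eqxx mulr_natr.
case: (boolP (P v)) => Pv.
  have [vl lc lP] := legP Pv.
  rewrite (bigD1 c) //= (bigD1 (leg v)) //= big1 => [|u /andP[uc ul]]; last first.
    by rewrite e_sym nbr_leg // (negPf uc) (negPf ul) mulr0.
  rewrite !(e_sym _ v) vl center // (fP _ Pv) l2 /f eqxx (negPf lc) (negPf lP).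
  by rewrite !mulr1 addr0 -natr1.
have [y vy] : exists y, e v y.
  have /connectP[[|y q] /=] := e_conn v c; first by move=> _ cv; rewrite cv eqxx in vc.
  by case/andP=> vy _ _; exists y.
have Py : P y by have := bipP vy; rewrite (negPf Pv); case: (P y).
rewrite (bigD1 y) //= big1 => [|u uy]; last first.
  case: (boolP (e u v)) => [uv|]; last by rewrite mulr0.
  have Pu : P u by have := bipP uv; rewrite (negPf Pv); case: (P u).
  have vl : v = leg y.
    by move: vy; rewrite e_sym nbr_leg // (negPf vc) => /eqP.
  by move: uv; rewrite vl => /leg_inj_edge uv; rewrite uv ?eqxx in uy.
by rewrite e_sym vy (fP _ Py) /f (negPf vc) (negPf Pv) addr0.
Qed.

End Spider.

(** * Choice of the colour class and conclusion *)

(* One of the two restrictions of a kernel vector to the colour classes is nonzero. *)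
Lemma kernel_colour (R : realType) (V : finType) (e : rel V) (Q : pred V) :
    (forall u v, e u v -> Q u != Q v) -> nullity R e = 1%N ->
  exists P : pred V, (forall u v, e u v -> P u != P v) /\
    exists f : V -> R, [/\ exists v, f v != 0, forall v, nbr_sum e f v = 0 &
                           forall v, P v -> f v = 0].
Proof.
move=> bipQ null1; have [f [[v fv] kerf]] := nullity1_kernel null1.
wlog Qv : Q bipQ / ~~ Q v => [IH|].
  case: (boolP (Q v)) => [Qv|Qv]; last exact: IH Qv.
  apply: (IH (predC Q)) => /=; last by rewrite negbK.
  by move=> u w /bipQ; case: (Q u); case: (Q w).
exists Q; split=> //; exists (fun u => if Q u then 0 else f u); split.
- by exists v; rewrite (negPf Qv).
- move=> u; case: (boolP (Q u)) => Qu.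
    rewrite -[RHS](kerf u); apply: eq_bigr => w _; case: ifP => // Qw.
    by case: (boolP (e w u)) => [/bipQ|]; rewrite ?Qu ?Qw ?mulr0.
  apply: big1 => w _; case: ifPn => [|Qw]; first by rewrite mul0r.
  by case: (boolP (e w u)) => [/bipQ|]; rewrite ?(negPf Qu) ?(negPf Qw) ?mulr0.
- by move=> u ->.
Qed.

Theorem theorem4p2 (R : realType) (V : finType) (e : rel V)
    (tree_e : is_tree e)
    (nullity_e : nullity R e = 1%N)
    (no_eigenvalue : forall a : R, eigenvalue (adjacency R e) a ->
       ~ (0 < a < 1 \/ 1 < a < 2)) :
  #|V| = 1%N \/ exists p : nat, (1 <= p)%N /\ graph_iso e (S_edge p).
Proof.
have [[e_sym e_irr] [V_gt0 e_conn] e_acy] := tree_e.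
have /card_gt0P[r _] := V_gt0.
(* The colouring is the parity of the distance to [r]; [P] is the class on which the kernel vector
   [f] vanishes, called Y in the overview. *)
have [P [bipP [f [[v0 fv0] kerf fP]]]] := kernel_colour
  (odd_dist_edge e_sym e_irr e_acy e_conn r) nullity_e.
have cardV : (#|V| <= (2 * #|P|).+1)%N.
  apply: leq_trans (nullity1_rank nullity_e) _.
  by rewrite ltnS rank_adjacency_bipartite.
have expands w : (forall v, ~~ P v -> w v = 0) ->
    \sum_v w v ^+ 2 <= \sum_v nbr_sum e w v ^+ 2 :> R.
  apply: (@nbr_sum_expands R V e P e_sym bipP) => [a /no_eigenvalue no a01|g gP kerg v].
    by apply: no; left.
  (* A kernel vector [g] supported on [P] is proportional to [f], and [f v0] is nonzero while
     [g v0 = 0]. *)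
  have := nullity1_proportional nullity_e kerf kerg v0 v.
  have Pv0 : ~~ P v0 by apply: contraNN fv0 => /fP ->.
  rewrite (gP _ Pv0) mulr0 => /eqP; rewrite mulf_eq0 (negPf fv0).
  by move/eqP.
have deg_ge2 y : P y -> (2 <= #|[set x | e y x]|)%N.
  (* If [x] were the only neighbour of [y], then [f x = 0], and another neighbour of [x] would lie
     in [P] and force degree at least 2 on [y]. So [x] and [y] would be the only vertices, and [f]
     vanishes at both. *)
  move=> Py; rewrite leqNgt; apply/negP => dy.
  have /eqP/cards1P[x /setP Ny] : #|[set x | e y x]| = 1%N.
    by have := degree_gt0 expands Py; lia.
  have yN u : e y u = (u == x) by have := Ny u; rewrite !inE.
  have fx : f x = 0.
    have := kerf y; rewrite /nbr_sum (bigD1 x) //= e_sym yN eqxx mulr1 big1 ?addr0 //.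
    by move=> u ux; rewrite e_sym yN (negPf ux) mulr0.
  have : v0 \in [set x; y].
    apply: (@connect_invariant _ e e_conn (fun v => v \in [set x; y]) x v0); last first.
      by rewrite !inE eqxx.
    move=> u v; rewrite !inE => /orP[/eqP ->|/eqP ->]; last by rewrite yN => ->.
    move=> xv; have [->|vy] := eqVneq v y; first by rewrite orbT.
    have Pv : P v.
      have := bipP _ _ xv; have := bipP y x; rewrite yN eqxx Py => /(_ isT).
      by case: (P x); case: (P v).
    have yx : e y x by rewrite yN.
    have vx : e v x by rewrite e_sym.
    have yv : y != v by rewrite eq_sym.
    by have := degree_gt1 expands Py Pv yv yx vx; lia.
  by rewrite !inE => /orP[] /eqP v0E; move: fv0; rewrite v0E ?fx ?fP ?eqxx.
have deg2 y : P y -> #|[set x | e y x]| = 2%N.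
  (* The degrees over [P] sum to at most [#|V| - 1 <= 2 * #|P|], and each is at least 2, so all
     equal 2. *)
  have le_sum : (\sum_(y | P y) #|[set x | e y x]| <= \sum_(y | P y) 2)%N.
    rewrite sum_nat_const mulnC -ltnS; apply: leq_trans cardV.
    exact: (sum_degrees_lt e_sym e_irr e_acy e_conn r).
  have [_ /esym] := leqif_sum (fun y Py => leqif_eq (deg_ge2 y Py)).
  by rewrite eqn_leq le_sum leq_sum // => /forall_inP all2 /all2 /eqP.
have share y z : P y -> P z -> exists2 u, e y u & e z u.
  move=> Py Pz.
  (* An invariant that passes through both colours: a vertex of [P] shares a neighbour with [y], and
     a vertex off [P] is adjacent to some [t] in [P] that does. *)
  pose C v := if P v then [exists u, e y u && e v u]
              else [exists t, [&& P t, e t v & [exists u, e y u && e t u]]].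
  have : C z.
    apply: (@connect_invariant _ e e_conn C y z) => [u v|]; last first.
      have /card_gt0P[u] := degree_gt0 expands Py; rewrite inE => yu.
      by rewrite /C Py; apply/existsP; exists u; rewrite yu.
    rewrite /C => + uv; have := bipP _ _ uv.
    case: (boolP (P u)); case: (boolP (P v)) => // Pv Pu _.
      by move=> sh; apply/existsP; exists u; rewrite Pu uv.
    move=> /existsP[t /and3P[Pt tu /existsP[x /andP[yx tx]]]].
    have vu : e v u by rewrite e_sym.
    have [w yw vw] := share_trans expands Py Pt Pv (deg2 _ Py) (deg2 _ Pt) (deg2 _ Pv)
      yx tx tu vu.
    by apply/existsP; exists w; rewrite yw.
  by rewrite /C Pz => /existsP[u /andP[yu zu]]; exists u.
have [P0|P_gt0] := posnP #|P|; first by left; lia.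
right; have /card_gt0P[y0 Py0] := P_gt0.
have [c center] := exists_center e_sym e_acy bipP deg2 share Py0.
have [P_small|P_ge3] := leqP #|P| 2; last first.
  exists (#|P|.-2); split; first lia.
  apply: (spider_iso e_sym e_irr e_acy bipP deg2 center P_gt0) => //; lia.
(* With one or two legs the eigenvalue is the square root of 2 or 3, strictly between 1 and 2. *)
case: (no_eigenvalue _ (spider_eigenvalue e_sym e_irr e_acy e_conn bipP deg2 center P_gt0 R)).
right; apply/andP; split.
  by rewrite -{1}sqrtr1 ltr_sqrt ?ltr1n.
have -> : 2 = Num.sqrt (4 : R).
  by rewrite (_ : 4 = 2 ^+ 2) ?sqrtr_sqr ?ger0_norm //; ring.
by rewrite ltr_sqrt // ltr_nat; lia.
Qed.
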